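(* Let $H$ be a cosovereign Hopf algebra over a field $k$ with sovereign character $u$, let $A$ be a finite dimensional right $H$-comodule algebra, and let $f:A\to A$, $f(a)=u^{-1}\cdot a=\sum u^{-1}(a_1)a_0$. The following are equivalent. (1) $A$ is $(H,u)$-symmetric. (2) There exists a nondegenerate bilinear form $B:A\times A\to k$ such that $B(b,ca)=B(bf(c),a)$, $B(b,a)=B(f(a),b)$ and $B(b,h^*\cdot a)=B((h^*S)\cdot b,a)$ for any $a,b,c\in A$, $h^*\in H^*$. (3) There exists a linear map $\lambda:A\to k$ such that $\lambda(ba)=\lambda(af(b))$ and $\lambda(h^*\cdot a)=h^*(1)\lambda(a)$ for any $a,b\in A$, $h^*\in H^*$, and $\mathrm{Ker}\,\lambda$ does not contain a non-zero right ideal of $A$. (4) There exists a linear map $\lambda:A\to k$ such that $\lambda(ba)=\lambda(af(b))$ and $\lambda(h^*\cdot a)=h^*(1)\lambda(a)$ for any $a,b\in A$, $h^*\in H^*$, and $\mathrm{Ker}\,\lambda$ does not contain a non-zero subobject of $A$ in $\mathcal{M}^H_A$ (i.e. a non-zero right ideal that is also an $H$-subcomodule). Moreover, these are also equivalent to the condition obtained from (3) by replacing ''right ideal'' with ''left ideal'', and to the condition obtained from (4) by replacing $\mathcal{M}^H_A$ with ${}_A\mathcal{M}^H$ (i.e. ''non-zero left ideal that is also an $H$-subcomodule'').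
   Context: $k$ is a field, $H$ is a Hopf algebra over $k$ with antipode $S$, and $H^*$ is its dual algebra (convolution product). A right $H$-comodule algebra is an algebra $A$ in the monoidal category $\mathcal{M}^H$ of right $H$-comodules; its coaction is written $a\mapsto\sum a_0\otimes a_1\in A\otimes H$. Any right $H$-comodule $M$ is a left $H^*$-module by $h^*\cdot m=\sum h^*(m_1)m_0$. $h^*S$ denotes the composition $h^*\circ S$. $H$ is cosovereign with sovereign character $u$ if $u:H\to k$ is an algebra morphism with $S^2(h)=\sum u^{-1}(h_1)u(h_3)h_2$ for all $h\in H$, where $u^{-1}=u\circ S$ is the convolution inverse of $u$. $\mathcal{M}^H_A$, ${}_A\mathcal{M}^H$, ${}_A\mathcal{M}^H_A$ denote the categories of right $A$-modules, left $A$-modules, $A,A$-bimodules in $\mathcal{M}^H$ (the actions are $H$-colinear: $\rho(ma)=\sum m_0a_0\otimes m_1a_1$ on the right, $\rho(am)=\sum a_0m_0\otimes a_1m_1$ on the left). For finite dimensional $A$, the dual $A^*$ is a right $H$-comodule with coaction $a^*\mapsto\sum a^*_0\otimes a^*_1$ determined by $\sum a^*_0(a)a^*_1=\sum a^*(a_0)S(a_1)$ for all $a\in A$; equivalently $(h^*\cdot a^* )(a)=a^*((h^*S)\cdot a)$. Let $F(A^* )$ be $A^*$ with this coaction, with the usual right $A$-action $(a^*a)(b)=a^*(ab)$, and with the left $A$-action $a*a^*$ given by $(a*a^* )(b)=a^*(bf(a))$, where $f(a)=u^{-1}\cdot a$. Then $F(A^* )\in{}_A\mathcal{M}^H_A$.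 Definition: a finite dimensional right $H$-comodule algebra $A$ is $(H,u)$-symmetric if $F(A^* )\simeq A$ in ${}_A\mathcal{M}^H_A$. *)

(* Defs.v *)
From HB Require Import structures.
From mathcomp Require Import all_boot all_order all_algebra.
From mathcomp Require Import falgebra boolp.
Set Implicit Arguments.
Unset Strict Implicit.
Unset Printing Implicit Defensive.
Import GRing.Theory.
Local Open Scope ring_scope.
Local Open Scope quotient_scope.

(* Tensor product of k-vector spaces: formal sums of pure tensors modulo the
   relation "equal under every bilinear map".  tlift_pure, tlift_linear and
   tensor_ind are the universal property. *)
Section TensorDef.
Variables (k : fieldType) (V W : lmodType k).

Definition bilin (U : lmodType k) (b : V -> W -> U) : Prop :=
  bilinear_for *:%R *:%R b.

Definition tsum (U : lmodType k) (b : V -> W -> U) (s : seq (V * W)) : U :=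
  \sum_(p <- s) b p.1 p.2.

Definition tens_rel (s t : seq (V * W)) : bool :=
  `[< forall (U : lmodType k) (b : V -> W -> U), bilin b ->
        tsum b s = tsum b t >].

Lemma tens_rel_refl : reflexive tens_rel.
Proof. by move=> s; apply/asboolP. Qed.

Lemma tens_rel_sym : symmetric tens_rel.
Proof.
by move=> s t; apply/asboolP/asboolP => h U b bb; rewrite h.
Qed.

Lemma tens_rel_trans : transitive tens_rel.
Proof.
move=> t s r /asboolP h1 /asboolP h2; apply/asboolP => U b bb.
by rewrite h1 // h2.
Qed.

Canonical tens_equiv :=
  EquivRel tens_rel tens_rel_refl tens_rel_sym tens_rel_trans.

Definition tensor := {eq_quot tens_equiv}.
HB.instance Definition _ := Choice.on tensor.
HB.instance Definition _ := EqQuotient.on tensor.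

Definition tpure (v : V) (w : W) : tensor := \pi_tensor [:: (v, w)].

(* Meaningful (independent of the representative) when b is bilinear; this is
   then the linear map V ⊗ W -> U induced by b. *)
Definition tlift (U : lmodType k) (t : tensor) (b : V -> W -> U) : U :=
  tsum b (repr t).

Lemma tlift_pi (U : lmodType k) (b : V -> W -> U) s :
  bilin b -> tlift (\pi_tensor s) b = tsum b s.
Proof.
move=> bb; rewrite /tlift.
have /eqmodP/asboolP : repr (\pi_tensor s) = s %[mod_eq tens_equiv].
  by rewrite reprK.
exact.
Qed.

Lemma tsum_cat (U : lmodType k) (b : V -> W -> U) s t :
  tsum b (s ++ t) = tsum b s + tsum b t.
Proof. exact: big_cat. Qed.

Lemma tsumZ (U : lmodType k) (b : V -> W -> U) c s : bilin b ->
  tsum b [seq (c *: p.1, p.2) | p <- s] = c *: tsum b s.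
Proof.
move=> bb; rewrite /tsum big_map scaler_sumr; apply: eq_bigr => p _ /=.
exact: (scalable_linear (bb.1 p.2)).
Qed.

Lemma tensP s t :
  (forall (U : lmodType k) (b : V -> W -> U), bilin b -> tsum b s = tsum b t) ->
  \pi_tensor s = \pi_tensor t.
Proof. by move=> h; apply/eqmodP/asboolP. Qed.

Lemma tens_reprP (U : lmodType k) (b : V -> W -> U) s : bilin b ->
  tsum b (repr (\pi_tensor s)) = tsum b s.
Proof. exact: tlift_pi. Qed.

Definition tzero : tensor := \pi_tensor [::].
Definition tadd (s t : tensor) : tensor := \pi_tensor (repr s ++ repr t).
Definition tscale (c : k) (s : tensor) : tensor :=
  \pi_tensor [seq (c *: p.1, p.2) | p <- repr s].
Definition topp (s : tensor) : tensor := tscale (-1) s.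

Ltac tens_tac :=
  rewrite /tadd /topp /tscale /tzero;
  let U := fresh "U" in let b := fresh "b" in
  apply: tensP => U b ?; rewrite ?(tsum_cat, tens_reprP, tsumZ) //.

Lemma taddA : associative tadd.
Proof. by move=> x y z; tens_tac; rewrite addrA. Qed.
Lemma taddC : commutative tadd.
Proof. by move=> x y; tens_tac; rewrite addrC. Qed.
Lemma tadd0 : left_id tzero tadd.
Proof.
move=> x; rewrite -[RHS]reprK; tens_tac.
by rewrite /tsum big_nil add0r.
Qed.
Lemma taddN : left_inverse tzero topp tadd.
Proof.
by move=> x; tens_tac; rewrite scaleN1r addNr /tsum big_nil.
Qed.
HB.instance Definition _ := GRing.isZmodule.Build tensor taddA taddC tadd0 taddN.

Lemma tscaleA a b v : tscale a (tscale b v) = tscale (a * b) v.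
Proof. by tens_tac; rewrite scalerA. Qed.
Lemma tscale1 : left_id 1 tscale.
Proof. by move=> x; rewrite -[RHS]reprK; tens_tac; rewrite scale1r. Qed.
Lemma tscaleDr : right_distributive tscale +%R.
Proof.
by move=> c x y; rewrite /GRing.add /=; tens_tac; rewrite scalerDr.
Qed.
Lemma tscaleDl v : {morph tscale^~ v : a b / a + b}.
Proof.
by move=> a b /=; rewrite [in RHS]/GRing.add /=; tens_tac; rewrite scalerDl.
Qed.
HB.instance Definition _ :=
  GRing.Zmodule_isLmodule.Build k tensor tscaleA tscale1 tscaleDr tscaleDl.

Lemma tpure_bilinear : bilin tpure.
Proof.
split=> [w|v] c x y; rewrite /GRing.add /GRing.scale /= /tpure;
  rewrite /tadd /tscale; apply: tensP => U b bb;
  rewrite tsum_cat !tens_reprP // tsumZ // tens_reprP // /tsum !big_seq1 /=.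
  exact: bb.1.
exact: bb.2.
Qed.
HB.instance Definition _ :=
  bilinear_isBilinear.Build k V W tensor *:%R *:%R tpure tpure_bilinear.

Lemma tlift_pure (U : lmodType k) (b : V -> W -> U) v w :
  bilin b -> tlift (tpure v w) b = b v w.
Proof. by move=> bb; rewrite tlift_pi // /tsum big_seq1. Qed.

Lemma tlift_linear (U : lmodType k) (b : V -> W -> U) :
  bilin b -> linear (fun t => tlift t b).
Proof.
move=> bb c x y; rewrite [in LHS]/GRing.add [in LHS]/GRing.scale /=.
by rewrite !(tlift_pi, tsum_cat, tens_reprP, tsumZ).
Qed.

Definition tlift_lin (U : lmodType k) (b : V -> W -> U) (bb : bilin b) :
  {linear tensor -> U} :=
  HB.pack (fun t : tensor => tlift t b)
    (GRing.isLinear.Build _ _ _ _ _ (tlift_linear bb)).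

Lemma tensorE (t : tensor) : t = \sum_(p <- repr t) tpure p.1 p.2.
Proof.
rewrite -[LHS]reprK; elim: (repr t) => [|p s IH]; first by rewrite big_nil.
rewrite big_cons -IH [in RHS]/GRing.add /= /tpure; tens_tac.
by rewrite -tsum_cat -surjective_pairing.
Qed.

Lemma tensor_ind (P : tensor -> Prop) :
  P 0 -> (forall v w t, P t -> P (tpure v w + t)) -> forall t, P t.
Proof.
move=> P0 Pp t; rewrite (tensorE t).
by elim: (repr t) => [|p s IH]; rewrite ?big_nil ?big_cons //; apply: Pp.
Qed.

End TensorDef.

Notation "V ⊗ W" := (tensor V W) (at level 40, left associativity) : type_scope.
Notation "v ⊗ w" := (tpure v w) (at level 40, left associativity) : ring_scope.

(* Sweedler notation: \sw_(x , y <- t) E is the sum of the E(x_i, y_i) where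
   t is the sum of the x_i ⊗ y_i. *)
Notation "\sw_ ( x , y <- t ) E" := (tlift t (fun x y => E))
  (at level 41, x name, y name, E at level 41,
   format "\sw_ ( x ,  y  <-  t )  E") : ring_scope.

HB.mixin Record Algebra_isHopf (k : fieldType) H of GRing.Algebra k H := {
  comul : H -> H ⊗ H;
  counit : H -> k;
  antipode : H -> H;
  comul_is_linear : linear comul;
  counit_is_scalar : scalar counit;
  antipode_is_linear : linear antipode;
  comulA : forall h,
    \sw_(x, h3 <- comul h) \sw_(h1, h2 <- comul x) h1 ⊗ (h2 ⊗ h3)
    = \sw_(h1, x <- comul h) \sw_(h2, h3 <- comul x) h1 ⊗ (h2 ⊗ h3);
  counitl : forall h, \sw_(h1, h2 <- comul h) (counit h1 *: h2) = h;
  counitr : forall h, \sw_(h1, h2 <- comul h) (counit h2 *: h1) = h;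
  comul1 : comul 1 = 1 ⊗ 1;
  comulM : forall g h, comul (g * h) =
    \sw_(g1, g2 <- comul g) \sw_(h1, h2 <- comul h) ((g1 * h1) ⊗ (g2 * h2));
  counit1 : counit 1 = 1;
  counitM : forall g h, counit (g * h) = counit g * counit h;
  antipodel : forall h,
    \sw_(h1, h2 <- comul h) (antipode h1 * h2) = (counit h)%:A;
  antipoder : forall h,
    \sw_(h1, h2 <- comul h) (h1 * antipode h2) = (counit h)%:A
}.

#[short(type="hopfAlgType")]
HB.structure Definition HopfAlgebra (k : fieldType) :=
  {H of Algebra_isHopf k H & GRing.Algebra k H}.

HB.instance Definition _ (k : fieldType) (H : hopfAlgType k) :=
  GRing.isLinear.Build k H (H ⊗ H)%type _ (@comul k H) (@comul_is_linear k H).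
HB.instance Definition _ (k : fieldType) (H : hopfAlgType k) :=
  GRing.isLinear.Build k H k _ (@counit k H) (@counit_is_scalar k H).
HB.instance Definition _ (k : fieldType) (H : hopfAlgType k) :=
  GRing.isLinear.Build k H H _ (@antipode k H) (@antipode_is_linear k H).

HB.mixin Record Lmodule_isComodule (k : fieldType) (H : hopfAlgType k) M
    of GRing.Lmodule k M := {
  coact : M -> M ⊗ H;
  coact_is_linear : linear coact;
  coactA : forall m,
    \sw_(x, m2 <- coact m) \sw_(m0, m1 <- coact x) m0 ⊗ (m1 ⊗ m2)
    = \sw_(m0, x <- coact m) \sw_(m1, m2 <- comul x) m0 ⊗ (m1 ⊗ m2);
  coact_counit : forall m, \sw_(m0, m1 <- coact m) (counit m1 *: m0) = m
}.

#[short(type="comodType")]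
HB.structure Definition Comodule (k : fieldType) (H : hopfAlgType k) :=
  {M of Lmodule_isComodule k H M & GRing.Lmodule k M}.

HB.mixin Record Comodule_isComoduleAlgebra (k : fieldType) (H : hopfAlgType k) A
    of Comodule k H A & GRing.Algebra k A := {
  coact1 : coact (1 : A) = 1 ⊗ 1;
  coactM : forall a b : A, coact (a * b) =
    \sw_(a0, a1 <- coact a) \sw_(b0, b1 <- coact b)
      (a0 * b0) ⊗ (a1 * b1)
}.

#[short(type="comodAlgType")]
HB.structure Definition ComoduleAlgebra (k : fieldType) (H : hopfAlgType k) :=
  {A of Comodule_isComoduleAlgebra k H A & Comodule k H A & GRing.Algebra k A}.

#[short(type="finComodAlgType")]
HB.structure Definition FinComoduleAlgebra (k : fieldType) (H : hopfAlgType k) :=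
  {A of ComoduleAlgebra k H A & Falgebra k A}.

HB.instance Definition _ (k : fieldType) (H : hopfAlgType k) (M : comodType H) :=
  GRing.isLinear.Build k M (M ⊗ H)%type _ (@coact k H M) (@coact_is_linear k H M).

Section Sovereign.
Variables (k : fieldType) (H : hopfAlgType k).

Definition char_inv (u : H -> k) : H -> k := u \o antipode.

Definition sovereign_character (u : {lrmorphism H -> k | *%R}) : Prop :=
  forall h : H, antipode (antipode h) =
    \sw_(h1, x <- comul h) \sw_(h2, h3 <- comul x)
      (char_inv u h1 * u h3) *: h2.

(* The action of H^* on a comodule; h is meant to be linear. *)
Definition hact (M : comodType H) (h : H -> k) (m : M) : M :=
  \sw_(m0, m1 <- coact m) h m1 *: m0.

End Sovereign.

Notation "h ▷ m" := (hact h m) (at level 40, left associativity) : ring_scope.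

(* Isomorphism in the category of A,A-bimodules in M^H, whose morphisms are the
   linear maps preserving the three structure maps.  The record carries these
   maps without the axioms, which play no role in what an isomorphism is. *)
Section BimoduleIso.
Variables (k : fieldType) (H : hopfAlgType k) (A : comodAlgType H).

Record bimod_data := BimodData {
  bm_sort :> lmodType k;
  bm_lact : A -> bm_sort -> bm_sort;
  bm_ract : bm_sort -> A -> bm_sort;
  bm_coact : bm_sort -> bm_sort ⊗ H
}.

Definition bimod_mor (M N : bimod_data) (f : {linear M -> N}) : Prop :=
  [/\ forall a m, f (bm_lact a m) = bm_lact a (f m),
      forall m a, f (bm_ract m a) = bm_ract (f m) a &
      forall m, bm_coact (f m) = \sw_(m0, m1 <- bm_coact m) f m0 ⊗ m1].

Definition bimod_iso (M N : bimod_data) : Prop :=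
  exists (f : {linear M -> N}) (g : {linear N -> M}),
    [/\ bimod_mor f, bimod_mor g, cancel f g & cancel g f].

Definition regular_bimod : bimod_data :=
  @BimodData A (fun a b => a * b) (fun a b => a * b) (@coact k H A).

End BimoduleIso.

Section Symmetric.
Variables (k : fieldType) (H : hopfAlgType k) (A : finComodAlgType H).
Variable u : {lrmorphism H -> k | *%R}.

Local Notation dual := 'Hom(A, k^o).

Definition twist (a : A) : A := char_inv u ▷ a.

Definition dual_ract (phi : dual) (a : A) : dual :=
  linfun (fun b => phi (a * b)).

Definition dual_lact (a : A) (phi : dual) : dual :=
  linfun (fun b => phi (b * twist a)).

Lemma dual_ractE phi a b : dual_ract phi a b = phi (a * b).
Proof.
have lin : linear (fun b => phi (a * b) : k^o).
  by move=> c x y; rewrite mulrDr -scalerAr linearP.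
pose F : {linear A -> k^o} := HB.pack (fun b => phi (a * b) : k^o)
  (GRing.isLinear.Build _ _ _ _ _ lin).
exact: (lfunE F).
Qed.

Lemma dual_lactE a phi b : dual_lact a phi b = phi (b * twist a).
Proof.
have lin : linear (fun b => phi (b * twist a) : k^o).
  by move=> c x y; rewrite mulrDl -scalerAl linearP.
pose F : {linear A -> k^o} := HB.pack (fun b => phi (b * twist a) : k^o)
  (GRing.isLinear.Build _ _ _ _ _ lin).
exact: (lfunE F).
Qed.

(* Written with a basis of A and the dual basis; dual_coactE and
   dual_coact_unique show that this is the coaction of the dual comodule. *)
Definition dual_coact (phi : dual) : dual ⊗ H :=
  \sum_(i < \dim {:A})
    linfun (coord (vbasis {:A}) i : A -> k^o) ⊗
    \sw_(a0, a1 <- coact (vbasis {:A})`_i) (phi a0 : k) *: antipode a1.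

Lemma ev_bilinear (a : A) : bilin (fun (phi : dual) (h : H) => (phi a : k) *: h).
Proof.
split=> [h|phi] c x y /=; first by rewrite add_lfunE scale_lfunE scalerDl scalerA.
by rewrite scalerDr !scalerA mulrC.
Qed.

Lemma dual_coactE (phi : dual) (a : A) :
  \sw_(p0, p1 <- dual_coact phi) (p0 a : k) *: p1
  = \sw_(a0, a1 <- coact a) (phi a0 : k) *: antipode a1.
Proof.
have bphi : bilin (fun (a0 : A) (h : H) => (phi a0 : k) *: antipode h).
  split=> [h|x] c y z /=; first by rewrite linearP scalerDl scalerA.
  by rewrite linearP scalerDr !scalerA mulrC.
rewrite -[LHS]/(tlift_lin (ev_bilinear a) _) -[RHS]/(tlift_lin bphi _).
rewrite [in RHS](coord_vbasis (memvf a)) !linear_sum.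
apply: eq_bigr => i _; rewrite !linearZ /= tlift_pure; last exact: ev_bilinear.
by rewrite (lfunE (coord (vbasis {:A}) i : {linear A -> k^o})).
Qed.

Lemma dual_coact_unique (s t : dual ⊗ H) :
  (forall a : A, \sw_(p0, p1 <- s) (p0 a : k) *: p1
                 = \sw_(p0, p1 <- t) (p0 a : k) *: p1) ->
  s = t.
Proof.
pose E a := tlift_lin (ev_bilinear a).
pose b i : dual := linfun (coord (vbasis {:A}) i : A -> k^o).
suff exp r : r = \sum_(i < \dim {:A}) b i ⊗ E (vbasis {:A})`_i r.
  move=> st; rewrite [s]exp [t]exp; apply: eq_bigr => i _.
  by congr (_ ⊗ _); apply: st.
elim/tensor_ind: r => [|phi h r IH].
  by rewrite big1 // => i _; rewrite linear0 linear0r.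
have Ep a : E a (phi ⊗ h) = (phi a : k) *: h.
  by rewrite /E /= tlift_pure //; apply: ev_bilinear.
rewrite {1}IH; under [in RHS]eq_bigr => i _ do
  rewrite linearD linearDr Ep linearZr_LR -linearZl_LR.
rewrite big_split /=; congr (_ + _).
rewrite -linear_sumlz; congr (_ ⊗ _).
apply/lfunP => a; rewrite sum_lfunE [in LHS](coord_vbasis (memvf a)) linear_sum.
apply: eq_bigr => i _; rewrite linearZ scale_lfunE.
rewrite (lfunE (coord (vbasis {:A}) i : {linear A -> k^o})).
exact: mulrC.
Qed.

Definition dual_bimod : bimod_data A :=
  BimodData dual_lact dual_ract dual_coact.

Definition Hu_symmetric : Prop := bimod_iso dual_bimod (regular_bimod A).

Definition nondegenerate_form (B : A -> A -> k) : Prop :=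
  (forall a, (forall b, B a b = 0) -> a = 0) /\
  (forall b, (forall a, B a b = 0) -> b = 0).

Definition right_ideal (I : {vspace A}) : Prop :=
  forall x a, x \in I -> x * a \in I.

Definition left_ideal (I : {vspace A}) : Prop :=
  forall a x, x \in I -> a * x \in I.

(* coact maps I into the image of I ⊗ H in A ⊗ H *)
Definition subcomodule (I : {vspace A}) : Prop :=
  forall x, x \in I -> exists s : seq (A * H),
    {in s, forall p, p.1 \in I} /\ coact x = \sum_(p <- s) p.1 ⊗ p.2.

End Symmetric.

(* Main.v *)
Require Import Defs.
From HB Require Import structures.
From mathcomp Require Import all_boot all_order all_algebra.
From mathcomp Require Import falgebra boolp classical_sets.
Set Implicit Arguments.
Unset Strict Implicit.
Unset Printing Implicit Defensive.
Import GRing.Theory.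
Local Open Scope ring_scope.

(* Given lambda, put J a := lambda(a _).  The twisted trace identity makes J a
   bimodule map A -> F(A^* ), and invariance of lambda, contracted with the
   antipode, gives sum lambda(a_0 b) a_1 = sum lambda(a b_0) S(b_1), which is
   colinearity of J.  Hence Ker J is at once a right ideal, a left ideal and a
   subcomodule inside Ker lambda, so that the weakest conditions, on subobjects
   only, already force J to be an isomorphism by dimension count. *)

(** * Linear functionals separate the points of any vector space, by Zorn *)

Section SeparatingFunctional.
Variables (k : fieldType) (V : lmodType k).
Local Open Scope classical_set_scope.

(* A maximal subspace W avoiding v is a hyperplane complementing the line of v. *)
Lemma separating_functional (v : V) :
  v <> 0 -> exists h : {scalar V}, h v <> 0.
Proof.
move=> v0.
pose lc (W : set V) := forall c x y, W x -> W y -> W (c *: x + y).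
pose P (W : set V) := lc W /\ ~ W v.
case: (@Zorn_bigcup V P).
  move=> F FP Ftot; split; last by case=> X FX; exact: (FP _ FX).2.
  move=> c x y [X FX Xx] [Y FY Yy].
  by case: (Ftot X Y FX FY) => s;
    [exists Y | exists X] => //; apply: (FP _ _).1 => //; apply: s.
move=> W [[Wlc Wv] Wmax].
(* [lc] does not put 0 in the set, so that the union of an empty chain satisfies [P]. If the maximal
   [W] missed 0 it would be empty, and the zero subspace would be strictly larger. *)
have W0 : W 0.
  apply: contrapT => nW0; pose X : set V := [set 0].
  apply: (Wmax X); first split.
  - by move=> x Wx; exfalso; apply: nW0; rewrite -(addNr x) -scaleN1r; apply: Wlc.
  - by move=> s; apply: nW0; apply: s.
  - by split=> [c x y -> ->|//]; rewrite scaler0 addr0.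
have WZ c x : W x -> W (c *: x) by move=> Wx; rewrite -[_ *: _]addr0; apply: Wlc.
(* Otherwise [W] plus the line of [x] is strictly larger and still avoids [v]: in a relation v = c x
   + w the scalar c is nonzero, and solving for x gives the coefficient 1/c. *)
have ex x : exists c, W (x - c *: v).
  apply: contrapT => nx.
  pose X : set V := [set y | exists c, exists2 w, W w & y = c *: x + w].
  apply: (Wmax X); first split.
  - by move=> w Ww; exists 0, w => //; rewrite scale0r add0r.
  - move=> s; apply: nx; exists 0; rewrite scale0r subr0; apply: s.
    by exists 1, 0 => //; rewrite scale1r addr0.
  - split=> [c y z [d [w Ww ->]] [e [w' Ww' ->]]|[c [w Ww E]]].
      exists (c * d + e), (c *: w + w'); first exact: Wlc.
      by rewrite scalerDr scalerA scalerDl addrACA.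
    have [c0|c0] := eqVneq c 0.
      by apply: Wv; rewrite E c0 scale0r add0r.
    apply: nx; exists c^-1.
    have -> : x - c^-1 *: v = (- c^-1) *: w.
      rewrite {1}E scalerDr scalerA mulVf // scale1r opprD addrA subrr add0r.
      by rewrite scaleNr.
    exact: WZ.
have uniq_c x c d : W (x - c *: v) -> W (x - d *: v) -> c = d.
  move=> Wc Wd; apply/eqP/negP => /negP ncd; apply: Wv.
  have := Wlc (-1) _ _ Wc Wd.
  rewrite scaleN1r opprB addrA addrNK -scalerBl => /(WZ (c - d)^-1).
  by rewrite scalerA mulVf ?subr_eq0 // scale1r.
have [h hP] := choice ex.
have lin : scalar h.
  move=> c x y; apply: (uniq_c (c *: x + y)) => //.
  have -> : c *: x + y - (c * h x + h y) *: v
     = c *: (x - h x *: v) + (y - h y *: v).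
    by rewrite scalerDl scalerBr scalerA opprD addrACA.
  exact: Wlc.
pose F : {scalar V} := HB.pack h (GRing.isLinear.Build _ _ _ _ _ lin).
exists F => /= hv.
by move: (hP v); rewrite hv scale0r subr0 => /Wv.
Qed.

(** Serves to turn invariance under every functional on [H], which may have infinite dimension, into
    one identity in [H]. *)
Lemma scalar_separates (v w : V) : (forall h : {scalar V}, h v = h w) -> v = w.
Proof.
move=> hvw; apply/eqP; rewrite -subr_eq0; apply/eqP; apply: contrapT.
by case/separating_functional=> h; rewrite linearB hvw subrr.
Qed.

End SeparatingFunctional.

(** * The coaction as a matrix with entries in [H] *)

Section CoactionMatrix.
Variables (k : fieldType) (H : hopfAlgType k) (A : finComodAlgType H).

Local Notation e := (vbasis {:A}).
Local Notation n := (\dim {:A}).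

Lemma tlift_coord_bilinear (i : 'I_n) :
  bilin (fun (a : A) (h : H) => coord e i a *: h).
Proof.
split=> [h|a] c x y /=; first by rewrite linearP scalerDl scalerA.
by rewrite scalerDr !scalerA mulrC.
Qed.

(** Replaces Sweedler sums by sums over a fixed basis, which can be exchanged and compared
    termwise. *)
Definition coact_coef (i : 'I_n) (a : A) : H :=
  \sw_(a0, a1 <- coact a) coord e i a0 *: a1.

Lemma coact_coef_is_linear i : linear (coact_coef i).
Proof.
by move=> c x y; rewrite /coact_coef linearP tlift_linear //;
  apply: tlift_coord_bilinear.
Qed.
HB.instance Definition _ i :=
  GRing.isLinear.Build k A H _ (coact_coef i) (coact_coef_is_linear i).

Lemma tlift_coact (U : lmodType k) (b : A -> H -> U) (a : A) : bilin b ->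
  tlift (coact a) b = \sum_(i < n) b e`_i (coact_coef i a).
Proof.
move=> bb.
pose F : {bilinear A -> H -> U | *:%R & *:%R} :=
  HB.pack b (bilinear_isBilinear.Build _ _ _ _ _ _ b bb).
rewrite /coact_coef /tlift /tsum.
under [RHS]eq_bigr => i _ do rewrite -[b _ _]/(F _ _) linear_sumr.
rewrite exchange_big; apply: eq_bigr => p _.
rewrite -[b _ _]/(F _ _) {1}(coord_vbasis (memvf p.1)) linear_sumlz.
by apply: eq_bigr => i _; rewrite linearZl_LR linearZr_LR.
Qed.

Lemma coactE (a : A) : coact a = \sum_(i < n) e`_i ⊗ coact_coef i a.
Proof.
by rewrite -(tlift_coact _ (@tpure_bilinear _ _ _)) [LHS]tensorE.
Qed.

(* Coassociativity makes c l m := coact_coef l e_m a multiplicative matrix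
   (comul (c l j) is the sum of the c l m ⊗ c m j), stated here after
   contraction with a bilinear map. *)
Lemma coact_coef_comul (U : lmodType k) (b : H -> H -> U) (l : 'I_n) (a : A) :
  bilin b ->
  \sum_(m < n) b (coact_coef l e`_m) (coact_coef m a)
  = \sw_(a0, a1 <- coact a) (coord e l a0 *: tlift (comul a1) b).
Proof.
move=> bb.
pose B := tlift_lin bb.
have bG : bilin (fun (x : A) (t : (H ⊗ H)%type) => coord e l x *: B t).
  split=> [h|x] c y z; first by rewrite /= linearP scalerDl scalerA.
  by rewrite (linearP B) scalerDr scalerA mulrC -scalerA.
pose G := tlift_lin bG.
have Gp x y z : G (x ⊗ (y ⊗ z)) = coord e l x *: b y z.
  by rewrite /G /= tlift_pure // /B /= tlift_pure.
pose F : {bilinear H -> H -> U | *:%R & *:%R} :=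
  HB.pack b (bilinear_isBilinear.Build _ _ _ _ _ _ b bb).
move: G Gp => {bG} G Gp.
(* [G] takes coordinate [l] of the first leg and applies [b] to the other two. *)
have := congr1 G (coactA a).
rewrite ![tlift (coact a) _]/tlift /tsum !linear_sum => E.
rewrite -(@tlift_coact _ (fun x y => b (coact_coef l x) y)); last first.
  split=> [h|x] c y z; first by rewrite linearP bb.1.
  exact: bb.2.
transitivity (\sum_(p <- repr (coact a))
   G (\sw_(m0, m1 <- coact p.1) m0 ⊗ (m1 ⊗ p.2))).
  apply: eq_bigr => p _; rewrite /tlift /tsum linear_sum.
  rewrite -[b _ _]/(F _ _) /coact_coef /tlift /tsum linear_sumlz.
  by apply: eq_bigr => q _; rewrite Gp linearZl_LR.
rewrite E; apply: eq_bigr => p _; rewrite /tlift /tsum scaler_sumr linear_sum.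
by apply: eq_bigr => q _; rewrite Gp.
Qed.

Lemma sum_coord_counit (l : 'I_n) (a : A) :
  \sw_(a0, a1 <- coact a) (coord e l a0 *: (counit a1)%:A)
  = (coord e l a)%:A :> H.
Proof.
rewrite -[in RHS](coact_counit a) /tlift /tsum linear_sum scaler_suml.
by apply: eq_bigr => p _; rewrite scalerA linearZ mulrC.
Qed.

(** The antipode axiom collapses the comultiplied second leg to its counit. At basis vectors [a]
    this says that the antipode, applied entrywise, gives a right inverse of the coaction matrix. *)
Lemma mul_antipoder (l : 'I_n) (a : A) :
  \sum_(m < n) coact_coef l e`_m * antipode (coact_coef m a)
  = (coord e l a)%:A.
Proof.
rewrite (@coact_coef_comul _ (fun x y => x * antipode y)) -?sum_coord_counit.
  by apply: eq_bigr => p _ /=; rewrite antipoder.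
split=> [h|x] c y z; first by rewrite mulrDl -scalerAl.
by rewrite linearP mulrDr -scalerAr.
Qed.

Lemma antipode1 : antipode (1 : H) = 1.
Proof.
have := antipodel (1 : H); rewrite comul1 counit1 scale1r tlift_pure ?mulr1 //.
split=> [h|x] c y z; first by rewrite linearP mulrDl -scalerAl.
by rewrite mulrDr -scalerAr.
Qed.

Lemma hact1 (h : {scalar H}) : h ▷ (1 : A) = (h 1)%:A.
Proof.
rewrite /hact coact1 tlift_pure //.
split=> [x|x] c y z /=; first by rewrite scalerDr !scalerA mulrC.
by rewrite linearP scalerDl scalerA.
Qed.

Lemma hact_antipode1 (h : {scalar H}) : (h \o antipode) ▷ (1 : A) = (h 1)%:A.
Proof. by rewrite hact1 /= antipode1. Qed.

End CoactionMatrix.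

Lemma dual_separates (k : fieldType) (V : vectType k) (x : V) :
  (forall phi : 'Hom(V, k^o), phi x = 0) -> x = 0.
Proof.
move=> phi0; rewrite (coord_vbasis (memvf x)) big1 // => i _.
have := phi0 (linfun (coord (vbasis {:V}) i : V -> k^o)).
rewrite (lfunE (coord (vbasis {:V}) i : {linear V -> k^o})) => ->.
exact: scale0r.
Qed.

(** * Inverses of bimodule morphisms *)

Section BimoduleMorphism.
Variables (k : fieldType) (H : hopfAlgType k) (A : comodAlgType H).

Lemma tmap_bilinear (V W : lmodType k) (g : {linear V -> W}) :
  bilin (fun (v : V) (h : H) => g v ⊗ h).
Proof.
split=> [h|v] c y z; last exact: (tpure_bilinear _ _).2.
by rewrite linearP; apply: (tpure_bilinear _ _).1.
Qed.

(** Thanks to this, an isomorphism needs its compatibilities checked in one direction only. *)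
Lemma bimod_mor_inv (M N : bimod_data A) (f : {linear M -> N})
    (g : {linear N -> M}) :
  cancel f g -> cancel g f -> bimod_mor g -> bimod_mor f.
Proof.
move=> fK gK [gl gr gc]; split=> [a m|m a|m].
- by apply: (can_inj gK); rewrite gl !fK.
- by apply: (can_inj gK); rewrite gr !fK.
rewrite -{2}[m]fK gc.
rewrite -[RHS]/(tlift_lin (tmap_bilinear f) _) [X in tlift_lin _ X]/tlift /tsum.
rewrite linear_sum [LHS]tensorE; apply: eq_bigr => p _ /=.
by rewrite tlift_pure ?gK //; apply: tmap_bilinear.
Qed.

End BimoduleMorphism.

(** * The map J attached to a functional, and its kernel *)

Section Frobenius.
Variables (k : fieldType) (H : hopfAlgType k) (A : finComodAlgType H).
Variable u : {lrmorphism H -> k | *%R}.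
Variable lambda : 'Hom(A, k^o).

Local Notation e := (vbasis {:A}).
Local Notation n := (\dim {:A}).

Lemma dual_ract_is_linear : linear (dual_ract lambda).
Proof.
move=> c x y; apply/lfunP => b.
by rewrite add_lfunE scale_lfunE !dual_ractE mulrDl -scalerAl linearP.
Qed.
HB.instance Definition _ :=
  GRing.isLinear.Build k A _ _ (dual_ract lambda) dual_ract_is_linear.

Definition frobenius_map : 'Hom(A, 'Hom(A, k^o)) := linfun (dual_ract lambda).

Lemma frobenius_mapE a b : frobenius_map a b = lambda (a * b).
Proof. by rewrite lfunE /= dual_ractE. Qed.

Lemma mem_lker_frobenius x :
  x \in lker frobenius_map <-> forall b, lambda (x * b) = 0.
Proof.
rewrite memv_ker; split=> [/eqP x0 b|x0]; first by rewrite -frobenius_mapE x0 lfunE.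
by apply/eqP/lfunP => b; rewrite frobenius_mapE x0 lfunE.
Qed.

Lemma lker_frobenius_sub : (lker frobenius_map <= lker lambda)%VS.
Proof.
apply/subvP => x /mem_lker_frobenius/(_ 1).
by rewrite mulr1 memv_ker => ->.
Qed.

Lemma lker_frobenius_right_ideal : right_ideal (lker frobenius_map).
Proof.
move=> x a /mem_lker_frobenius x0; apply/mem_lker_frobenius => b.
by rewrite -mulrA.
Qed.

(** [A] and its dual have the same dimension. *)
Lemma frobenius_surj : lker frobenius_map = 0%VS ->
  limg frobenius_map = fullv.
Proof.
move=> K0; apply/eqP; rewrite eqEdim subvf /= (limg_dim_eq _) ?K0 ?capv0 //.
by rewrite !dimvf /dim /= muln1.
Qed.

(** By surjectivity every functional is some [lambda (a * _)], which vanishes on [I]; hence all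
    functionals kill [I]. *)
Lemma left_ideal_in_lker (I : {vspace A}) : lker frobenius_map = 0%VS ->
  left_ideal I -> (I <= lker lambda)%VS -> I = 0%VS.
Proof.
move=> K0 Il Ik; apply/eqP; rewrite -subv0; apply/subvP => x xI.
rewrite memv0; apply/eqP/dual_separates => phi.
have /memv_imgP[a _ ->] : phi \in limg frobenius_map.
  by rewrite frobenius_surj // memvf.
rewrite frobenius_mapE; apply/eqP; rewrite -memv_ker.
by apply: (subvP Ik); apply: Il.
Qed.

Hypothesis lambda_twist : forall a b : A, lambda (b * a) = lambda (a * twist u b).
Hypothesis lambda_hact :
  forall (h : {scalar H}) (a : A), lambda (h ▷ a) = h 1 * lambda a.

(** The twisted trace identity carries a left factor [a] to the far right, as [twist u a]. *)
Lemma lker_frobenius_left_ideal : left_ideal (lker frobenius_map).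
Proof.
move=> a x /mem_lker_frobenius x0; apply/mem_lker_frobenius => b.
by rewrite -mulrA lambda_twist -mulrA.
Qed.

(** This is colinearity of [lambda] into the trivial comodule; it is tested against all functionals
    on [H]. *)
Lemma coinvariant (a : A) :
  \sw_(a0, a1 <- coact a) (lambda a0 : k) *: a1 = (lambda a : k)%:A.
Proof.
apply: scalar_separates => h; rewrite linearZ /= mulrC -[RHS]lambda_hact.
rewrite /hact /tlift /tsum !linear_sum; apply: eq_bigr => p _.
by rewrite !linearZ /= mulrC.
Qed.

Lemma coinvariant_mul (a b : A) :
  \sum_(i < n) \sum_(j < n)
     (lambda (e`_i * e`_j) : k) *: (coact_coef i a * coact_coef j b)
  = (lambda (a * b) : k)%:A.
Proof.
have bil : bilin (fun (x : A) (h : H) => (lambda x : k) *: h).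
  split=> [h|x] c y z /=; first by rewrite linearP scalerDl scalerA.
  by rewrite scalerDr !scalerA mulrC.
rewrite -coinvariant coactM.
rewrite tlift_coact; last first.
  split=> [h|x] c y z; rewrite /= /tlift /tsum scaler_sumr -big_split;
    apply: eq_bigr => p _ /=.
    by rewrite mulrDl -scalerAl (tpure_bilinear _ _).1.
  by rewrite mulrDl -scalerAl (tpure_bilinear _ _).2.
rewrite -[RHS]/(tlift_lin bil _) linear_sum; apply: eq_bigr => i _.
rewrite tlift_coact; last first.
  split=> [h|x] c y z.
    by rewrite mulrDr -scalerAr (tpure_bilinear _ _).1.
  by rewrite mulrDr -scalerAr (tpure_bilinear _ _).2.
by rewrite linear_sum; apply: eq_bigr => j _ /=; rewrite tlift_pure.
Qed.

(* Contract the invariance identity for a and b_0 with S(b_1) on the right. *)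
Lemma lambda_antipode (a b : A) :
  \sum_(i < n) (lambda (e`_i * b) : k) *: coact_coef i a
  = \sum_(j < n) (lambda (a * e`_j) : k) *: antipode (coact_coef j b).
Proof.
under [RHS]eq_bigr => m _ do rewrite -mulr_algl -coinvariant_mul mulr_suml.
rewrite exchange_big; apply: eq_bigr => i _ /=.
(* Here [b] is expanded in the basis, and [mul_antipoder] writes its coordinates as products of
   coefficients with antipodes. *)
transitivity (\sum_(j < n) (lambda (e`_i * e`_j) : k) *:
   (coact_coef i a * \sum_(m < n)
     (coact_coef j e`_m * antipode (coact_coef m b)))).
  rewrite {1}(coord_vbasis (memvf b)) mulr_sumr (linear_sum lambda) scaler_suml.
  apply: eq_bigr => j _.
  by rewrite mul_antipoder -scalerAr linearZ mulr_algr scalerA mulrC.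
under [RHS]eq_bigr => m _ do rewrite mulr_suml.
rewrite exchange_big; apply: eq_bigr => j _ /=.
rewrite mulr_sumr scaler_sumr; apply: eq_bigr => m _.
by rewrite -scalerAl mulrA.
Qed.

Lemma lker_frobenius_subcomodule : subcomodule (lker frobenius_map).
Proof.
move=> x /mem_lker_frobenius x0.
pose J := frobenius_map; pose g := (J^-1)%VF.
(* Subtracting [g (J e_i)] projects each [e_i] into the kernel. The total correction is [g] applied
   to the first leg of the sum of the [J e_i ⊗ coact_coef i x], which is zero by
   [lambda_antipode]. *)
exists [seq (e`_i - g (J e`_i), coact_coef i x) | i : 'I_n <- enum 'I_n]; split.
  move=> _ /mapP[i _ ->] /=; rewrite memv_ker linearB /= subr_eq0.
  by rewrite limg_lfunVK // memv_img ?memvf.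
rewrite big_map big_enum /= coactE.
under [RHS]eq_bigr => i _ do rewrite linearBl.
rewrite sumrB [X in _ - X](_ : _ = 0) ?subr0 //.
have J0 : \sum_(i < n) J e`_i ⊗ coact_coef i x = 0.
  apply: dual_coact_unique => a.
  rewrite -[LHS]/(tlift_lin (ev_bilinear a) _).
  rewrite -[RHS]/(tlift_lin (ev_bilinear a) _) linear0 linear_sum.
  transitivity (\sum_(i < n) (lambda (e`_i * a) : k) *: coact_coef i x).
    apply: eq_bigr => i _ /=; rewrite tlift_pure ?frobenius_mapE //.
    exact: ev_bilinear.
  by rewrite lambda_antipode big1 // => j _; rewrite x0 scale0r.
have := congr1 (tlift_lin (tmap_bilinear H g)) J0.
rewrite linear0 linear_sum; apply: etrans; apply: eq_bigr => i _ /=.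
by rewrite tlift_pure //; apply: tmap_bilinear.
Qed.

Lemma frobenius_bimod_mor :
  @bimod_mor _ _ _ (regular_bimod A) (dual_bimod A u) frobenius_map.
Proof.
split=> [a m|m a|m] /=.
- apply/lfunP => b.
  by rewrite dual_lactE !frobenius_mapE -mulrA lambda_twist mulrA.
- by apply/lfunP => b; rewrite dual_ractE !frobenius_mapE mulrA.
(* Evaluated at [b], colinearity becomes [lambda_antipode]. *)
apply: dual_coact_unique => b; rewrite dual_coactE.
have bil : bilin (fun (x : A) (h : H) => frobenius_map x ⊗ h).
  exact: tmap_bilinear.
rewrite (tlift_coact _ bil) -[RHS]/(tlift_lin (ev_bilinear b) _) linear_sum.
rewrite tlift_coact.
  under eq_bigr => i _ do rewrite frobenius_mapE.
  rewrite -lambda_antipode; apply: eq_bigr => i _ /=.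
  by rewrite tlift_pure ?frobenius_mapE //; apply: ev_bilinear.
split=> [h|x] c y z /=; first by rewrite linearP scalerDl scalerA.
by rewrite linearP scalerDr !scalerA mulrC.
Qed.

Lemma frobenius_Hu_symmetric : lker frobenius_map = 0%VS -> Hu_symmetric A u.
Proof.
move=> K0.
have gK : cancel frobenius_map (frobenius_map^-1)%VF.
  by apply: lker0_lfunK; rewrite K0.
have fK : cancel (frobenius_map^-1)%VF frobenius_map.
  by move=> phi; rewrite limg_lfunVK // frobenius_surj // memvf.
exists (frobenius_map^-1)%VF, frobenius_map; split=> //.
  exact: bimod_mor_inv frobenius_bimod_mor.
exact: frobenius_bimod_mor.
Qed.

End Frobenius.

(** * From an isomorphism to a form, and from a form to a functional *)

Section SymmetricForm.
Variables (k : fieldType) (H : hopfAlgType k) (A : finComodAlgType H).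
Variable u : {lrmorphism H -> k | *%R}.

Lemma Hu_symmetric_form : Hu_symmetric A u ->
  exists B : {biscalar A},
    [/\ nondegenerate_form B,
        forall a b c : A, B b (c * a) = B (b * twist u c) a,
        forall a b : A, B b a = B (twist u a) b &
        forall (h : {scalar H}) (a b : A),
          B b (h ▷ a) = B ((h \o antipode) ▷ b) a].
Proof.
case=> [F [G [_ [Gl Gr Gc] FK GK]]].
pose g : {linear A -> 'Hom(A, k^o)} := G.
(* The arguments are swapped so that left linearity of [G] becomes the first identity on [B]. *)
pose B0 (b a : A) : k := g a b.
have bil : bilinear_for *%R *%R B0.
  split=> [a|b] c x y; first by rewrite /B0 linearP.
  by rewrite /B0 linearP add_lfunE scale_lfunE.
pose B : {biscalar A} := HB.pack B0 (bilinear_isBilinear.Build _ _ _ _ _ _ B0 bil).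
have gl c a b : g (c * a) b = g a (b * twist u c).
  by rewrite [g _](Gl c a) dual_lactE.
have gr a b : g a b = g 1 (a * b).
  by rewrite -[a in LHS]mul1r [g _](Gr 1 a) dual_ractE.
exists B; split=> [|a b c|a b|h a b] //=; rewrite /B0.
- split=> [a|b] a0.
    by apply: dual_separates => phi; rewrite -[phi]FK -[RHS](a0 (F phi)).
  by apply: (can_inj GK); apply/lfunP => a; rewrite linear0 lfunE a0.
- exact: gl.
- by rewrite [in RHS]gr -gl mulr1.
(* Colinearity of [G] is evaluated at [b] and then under [h]; the dual coaction brings in the
   antipode. *)
have gc : dual_coact (g a) = \sw_(a0, a1 <- coact a) g a0 ⊗ a1 := Gc a.
have : h (tlift (dual_coact (g a)) (fun p0 p1 => (p0 b : k) *: p1))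
     = h (tlift (coact a) (fun a0 a1 => (g a0 b : k) *: a1)).
  rewrite gc; congr (h _).
  rewrite -[LHS]/(tlift_lin (ev_bilinear b) _) linear_sum.
  apply: eq_bigr => p _ /=.
  by rewrite tlift_pure //; apply: ev_bilinear.
rewrite dual_coactE /hact /tlift /tsum !linear_sum /= => E.
rewrite sum_lfunE; transitivity (\sum_(p <- repr (coact a)) h ((g p.1 b : k) *: p.2)).
  by apply: eq_bigr => p _; rewrite !linearZ scale_lfunE /= mulrC.
by rewrite -E; apply: eq_bigr => p _; rewrite !linearZ /= mulrC.
Qed.

(** The functional is [B 1], so [lambda (x * a)] is [B a x]: a right ideal in its kernel is
    orthogonal to all of [A]. Invariance follows since the antipode fixes 1. *)
Lemma form_functional (B : {biscalar A}) :
  nondegenerate_form B ->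
  (forall a b c : A, B b (c * a) = B (b * twist u c) a) ->
  (forall a b : A, B b a = B (twist u a) b) ->
  (forall (h : {scalar H}) (a b : A),
     B b (h ▷ a) = B ((h \o antipode) ▷ b) a) ->
  exists lambda : 'Hom(A, k^o),
    [/\ forall a b : A, lambda (b * a) = lambda (a * twist u b),
        forall (h : {scalar H}) (a : A), lambda (h ▷ a) = h 1 * lambda a &
        forall I : {vspace A}, right_ideal I ->
          (I <= lker lambda)%VS -> I = 0%VS].
Proof.
move=> [_ ndr] Bl Bt Bh.
have lin : linear (B 1 : A -> k^o) by move=> c x y; rewrite linearPr.
pose L : {linear A -> k^o} := HB.pack (B 1 : A -> k^o)
  (GRing.isLinear.Build _ _ _ _ _ lin).
have LE a : linfun (B 1 : A -> k^o) a = B 1 a by rewrite (lfunE L).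
have BE a b : B 1 (b * a) = B a b by rewrite Bl mul1r -Bt.
exists (linfun (B 1 : A -> k^o)); split=> [a b|h a|I Ir Ik].
- by rewrite !LE !BE -Bt.
- by rewrite !LE Bh hact_antipode1 linearZl_LR.
apply/eqP; rewrite -subv0; apply/subvP => x xI.
rewrite memv0; apply/eqP/ndr => a; rewrite -BE.
by have := subvP Ik _ (Ir x a xI); rewrite memv_ker LE => /eqP.
Qed.

End SymmetricForm.

Theorem proposition2p2 (k : fieldType) (H : hopfAlgType k)
    (u : {lrmorphism H -> k | *%R}) (A : finComodAlgType H)
    (hu : sovereign_character u) :
  let f : A -> A := twist u in
  [<->
   Hu_symmetric A u;
   exists B : {biscalar A},
     [/\ nondegenerate_form B,
         forall a b c : A, B b (c * a) = B (b * f c) a,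
         forall a b : A, B b a = B (f a) b &
         forall (h : {scalar H}) (a b : A),
           B b (h ▷ a) = B ((h \o antipode) ▷ b) a];
   exists lambda : 'Hom(A, k^o),
     [/\ forall a b : A, lambda (b * a) = lambda (a * f b),
         forall (h : {scalar H}) (a : A), lambda (h ▷ a) = h 1 * lambda a &
         forall I : {vspace A}, right_ideal I ->
           (I <= lker lambda)%VS -> I = 0%VS];
   exists lambda : 'Hom(A, k^o),
     [/\ forall a b : A, lambda (b * a) = lambda (a * f b),
         forall (h : {scalar H}) (a : A), lambda (h ▷ a) = h 1 * lambda a &
         forall I : {vspace A}, right_ideal I -> subcomodule I ->
           (I <= lker lambda)%VS -> I = 0%VS];
   exists lambda : 'Hom(A, k^o),
     [/\ forall a b : A, lambda (b * a) = lambda (a * f b),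
         forall (h : {scalar H}) (a : A), lambda (h ▷ a) = h 1 * lambda a &
         forall I : {vspace A}, left_ideal I ->
           (I <= lker lambda)%VS -> I = 0%VS];
   exists lambda : 'Hom(A, k^o),
     [/\ forall a b : A, lambda (b * a) = lambda (a * f b),
         forall (h : {scalar H}) (a : A), lambda (h ▷ a) = h 1 * lambda a &
         forall I : {vspace A}, left_ideal I -> subcomodule I ->
           (I <= lker lambda)%VS -> I = 0%VS]].
Proof.
move=> f; tfae.
- exact: Hu_symmetric_form.
- by case=> B [? ? ? ?]; apply: (@form_functional _ _ _ _ B).
- by case=> l [lt lh lk]; exists l; split=> // I Ir _; apply: lk.
(* The passage from right to left: Ker J is a right subobject, hence zero, and surjectivity of J
   then handles every left ideal. *)
- case=> l [lt lh lk]; exists l; split=> // I Il; apply: left_ideal_in_lker => //.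
  apply: lk; first exact: lker_frobenius_right_ideal.
    exact: lker_frobenius_subcomodule.
  exact: lker_frobenius_sub.
- by case=> l [lt lh lk]; exists l; split=> // I Il _; apply: lk.
(* The cycle closes because Ker J is a left subobject as well. *)
case=> l [lt lh lk]; apply: (frobenius_Hu_symmetric lt lh).
apply: lk; first exact: lker_frobenius_left_ideal lt.
  exact: lker_frobenius_subcomodule.
exact: lker_frobenius_sub.
Qed.
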